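(* For every $m\ge0$, $T_5(D^{6m+5})=D^{6m+1}+(\text{a sum of }D^{6r+1}\text{ with }r<m)$. In particular, $T_5:W5\to W1$ is bijective.
   Context: For an odd prime $p$, $T_p:\mathbb{Z}/2[[x]]\to\mathbb{Z}/2[[x]]$ is the map $\sum c_nx^n\mapsto\sum c_{pn}x^n+\sum c_nx^{pn}$. Let $D=\sum_{n>0,\ \gcd(n,6)=1}x^{n^2}$; let $W1$, $W5$ be the $\mathbb{Z}/2$-spans of the $D^k$ with $k>0$ and $k\equiv1\pmod6$, resp. $k\equiv5\pmod 6$. *)

(* Defs.v *)
From HB Require Import structures.
From mathcomp Require Import all_boot all_order all_algebra.
From mathcomp Require Import boolp classical_sets functions.

Set Implicit Arguments.
Unset Strict Implicit.
Unset Printing Implicit Defensive.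

Import GRing.Theory.
Local Open Scope ring_scope.

(* R[[x]]; a record rather than a bare alias of nat -> R, so that the Cauchy
   product is never confused with the pointwise product on functions. *)
Record fps (R : Type) : Type := Fps { fps_coef : nat -> R }.

Coercion fps_coef : fps >-> Funclass.

Lemma fpsP (R : Type) (f g : fps R) : (forall n, f n = g n) -> f = g.
Proof. by case: f g => [f] [g] /= fg; congr Fps; apply/funext. Qed.

HB.instance Definition _ (R : Type) := gen_eqMixin (fps R).
HB.instance Definition _ (R : Type) := gen_choiceMixin (fps R).

Section FpsZmodule.
Variable R : zmodType.
Implicit Types f g h : fps R.

Definition fps_zero : fps R := Fps (fun=> 0).
Definition fps_opp f : fps R := Fps (fun n => - f n).
Definition fps_add f g : fps R := Fps (fun n => f n + g n).

Fact fps_addA : associative fps_add.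
Proof. by move=> f g h; apply: fpsP => n /=; rewrite addrA. Qed.
Fact fps_addC : commutative fps_add.
Proof. by move=> f g; apply: fpsP => n /=; rewrite addrC. Qed.
Fact fps_add0 : left_id fps_zero fps_add.
Proof. by move=> f; apply: fpsP => n /=; rewrite add0r. Qed.
Fact fps_addN : left_inverse fps_zero fps_opp fps_add.
Proof. by move=> f; apply: fpsP => n /=; rewrite addNr. Qed.

HB.instance Definition _ :=
  GRing.isZmodule.Build (fps R) fps_addA fps_addC fps_add0 fps_addN.
End FpsZmodule.

Section FpsRing.
Variable R : comNzRingType.
Implicit Types f g h : fps R.

Definition fps_one : fps R := Fps (fun n => (n == 0%N)%:R).
Definition fps_mul f g : fps R :=
  Fps (fun n => \sum_(i < n.+1) f i * g (n - i)%N).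
Definition fps_scale (a : R) f : fps R := Fps (fun n => a * f n).

Let trunc N f : {poly R} := \poly_(i < N) f i.

Let trunc_mul N f g n : (n < N)%N ->
  (fps_mul f g) n = (trunc N f * trunc N g)`_n.
Proof.
move=> nN; rewrite coefM /=; apply: eq_bigr => i _; rewrite !coef_poly.
have iN : (i < N)%N by apply: leq_trans nN; exact: ltn_ord.
by rewrite iN (leq_ltn_trans (leq_subr _ _) nN).
Qed.

Fact fps_mulC : commutative fps_mul.
Proof.
move=> f g; apply: fpsP => n.
by rewrite !(trunc_mul _ _ (ltnSn n)) mulrC.
Qed.

Fact fps_mulA : associative fps_mul.
Proof.
move=> f g h; apply: fpsP => n.
transitivity ((trunc n.+1 f * trunc n.+1 g * trunc n.+1 h)`_n).
  rewrite -mulrA coefM /=; apply: eq_bigr => i _.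
  rewrite coef_poly ltn_ord; congr (_ * _).
  by apply: (@trunc_mul n.+1 g h); rewrite ltnS leq_subr.
rewrite coefM /=; apply: eq_bigr => i _.
rewrite [X in _ * X]coef_poly ltnS leq_subr; congr (_ * _).
by symmetry; apply: (@trunc_mul n.+1 f g); exact: ltn_ord.
Qed.

Fact fps_mul1 : left_id fps_one fps_mul.
Proof.
move=> f; apply: fpsP => n /=; rewrite big_ord_recl /= mul1r subn0.
by rewrite big1 ?addr0 // => i _; rewrite mul0r.
Qed.

Fact fps_mulDl : left_distributive fps_mul +%R.
Proof.
move=> f g h; apply: fpsP => n /=; rewrite -big_split /=.
by apply: eq_bigr => i _; rewrite mulrDl.
Qed.

Fact fps_one_neq0 : fps_one != 0.
Proof.
apply/eqP => /(congr1 (fun f => f 0)) /= /eqP.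
by rewrite oner_eq0.
Qed.

HB.instance Definition _ := GRing.Zmodule_isComNzRing.Build (fps R)
  fps_mulA fps_mulC fps_mul1 fps_mulDl fps_one_neq0.

Fact fps_scaleA a b f : fps_scale a (fps_scale b f) = fps_scale (a * b) f.
Proof. by apply: fpsP => n /=; rewrite mulrA. Qed.
Fact fps_scale1 : left_id 1 fps_scale.
Proof. by move=> f; apply: fpsP => n /=; rewrite mul1r. Qed.
Fact fps_scaleDr : right_distributive fps_scale +%R.
Proof. by move=> a f g; apply: fpsP => n /=; rewrite mulrDr. Qed.
Fact fps_scaleDl f : {morph fps_scale^~ f : a b / a + b}.
Proof. by move=> a b; apply: fpsP => n /=; rewrite mulrDl. Qed.

HB.instance Definition _ := GRing.Zmodule_isLmodule.Build R (fps R)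
  fps_scaleA fps_scale1 fps_scaleDr fps_scaleDl.

Fact fps_scaleAl (a : R) f g : a *: (f * g) = (a *: f) * g.
Proof.
apply: fpsP => n /=; rewrite mulr_sumr.
by apply: eq_bigr => i _; rewrite mulrA.
Qed.

HB.instance Definition _ :=
  GRing.Lmodule_isLalgebra.Build R (fps R) fps_scaleAl.
HB.instance Definition _ := GRing.Lalgebra_isComAlgebra.Build R (fps R).
End FpsRing.

Definition lspan (R : nzRingType) (V : lmodType R) (S : set V) : set V :=
  [set v | exists (n : nat) (a : 'I_n -> R) (u : 'I_n -> V),
             (forall i, S (u i)) /\ v = \sum_(i < n) a i *: u i].

(* The second summand is the x^n-coefficient of \sum_k c_k x^(p k). *)
Definition T (p : nat) (f : fps 'F_2) : fps 'F_2 :=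
  Fps (fun n => f (p * n)%N + (if (p %| n)%N then f (n %/ p)%N else 0)).

(* n |-> n^2 is injective, so every coefficient of D is 0 or 1. *)
Definition D : fps 'F_2 :=
  Fps (fun n => `[< exists k : nat, [/\ (0 < k)%N, gcdn k 6 = 1%N
                                      & n = (k ^ 2)%N] >]%:R).

Definition W1 : set (fps 'F_2) :=
  lspan [set f | exists k : nat, [/\ (0 < k)%N, (k = 1 %[mod 6])%N & f = D ^+ k]].

Definition W5 : set (fps 'F_2) :=
  lspan [set f | exists k : nat, [/\ (0 < k)%N, (k = 5 %[mod 6])%N & f = D ^+ k]].

(* Main.v *)
Require Import Defs.
From HB Require Import structures.
From mathcomp Require Import all_boot all_order all_algebra.
From mathcomp Require Import boolp classical_sets functions.
From mathcomp Require Import zify ring.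
Set Implicit Arguments.
Unset Strict Implicit.
Unset Printing Implicit Defensive.
Import GRing.Theory.
Local Open Scope ring_scope.

(** Write [C = D(x^5)].  Everything follows from the degree 5 modular equation
    [D^6 + C^6 = D C].  Writing [T_5 = U + V] with [V f = f(x^5)] and
    [U f = \sum c_(5n) x^n], the identity [U (V g * f) = g * U f] turns the
    modular equation into [T_5 (D^(n+6)) = D T_5 (D^(n+1)) + D^6 T_5 (D^n)].
    Since [T_5] commutes with squaring, the recurrence also supplies the initial
    values: [T_5 (D^k) = 0] for [k < 5] and [T_5 (D^5) = D].

    For the modular equation, [D] is the sum of [x^(k^2)] over all integers
    [k = 1 mod 6].  Hence the coefficients of [D^3 = D D(x^2)] and of [D C] count
    representations by [a^2 + 2 b^2] and [a^2 + 5 b^2]; their parities are found by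
    multiplication and conjugation in [Z[sqrt -2]] and [Z[sqrt -5]], which gives
    [D^3 = \sum_(k odd) x^(3 k^2)] and
    [D C = \sum_(k odd) (x^(6 k^2) + x^(30 k^2)) = (D^3)^2 + (C^3)^2]. *)

(** * Parity counts by involutions *)

(** Points that [g] moves cancel in pairs, and by the last hypothesis at most one fixed point
    remains. The induction removes a fixed head alone and any other head together with its image. *)
Lemma odd_size_involution (X : eqType) (s : seq X) (g : X -> X) :
    uniq s -> {in s, forall x, g x \in s} -> {in s, forall x, g (g x) = x} ->
    {in s &, forall x y, g x = x -> g y = y -> x = y} ->
  odd (size s) = has (fun x => g x == x) s.
Proof.
have [n] := ubnP (size s); elim: n s => // n IHn [|x s] //= le_sn /andP[xs us].
move=> gs gK guniq.
have gx : g x \in x :: s by apply: gs; rewrite mem_head.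
have [gxx|gxx] := eqVneq (g x) x.
  have sub y : y \in s -> y \in x :: s by rewrite in_cons => ->; rewrite orbT.
  have nhas : has (fun y => g y == y) s = false.
    apply/hasP => -[y ys /eqP gy]; move/negP: xs; apply.
    by rewrite (guniq x y) // ?mem_head ?sub.
  rewrite (IHn s) ?nhas //=.
  - move=> y ys; have := gs y (sub _ ys); rewrite in_cons => /predU1P[gyx|//].
    by move: xs; rewrite -gxx -gyx gK ?ys ?sub.
  - by move=> y /sub; exact: gK.
  - by move=> y z /sub ys /sub zs; exact: guniq.
move: gx; rewrite in_cons (negbTE gxx) /= => gx.
have gne : g (g x) == g x = false by rewrite gK ?mem_head // eq_sym (negbTE gxx).
rewrite (perm_size (perm_to_rem gx)) (perm_has _ (perm_to_rem gx)) /= gne negbK.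
have sub y : y \in rem (g x) s -> [/\ y \in x :: s, y != x & y != g x].
  rewrite mem_rem_uniq // !inE => /andP[ne ys].
  by rewrite ys orbT ne; split=> //; apply: contraNneq xs => <-.
have lt : (size (rem (g x) s) < n)%N.
  by move: le_sn; rewrite (perm_size (perm_to_rem gx)) /=; lia.
apply: IHn => //; first exact: rem_uniq.
- move=> y /sub[ys yx ygx]; have := gs y ys.
  rewrite mem_rem_uniq // !inE => /predU1P[gyx|->].
    by move: ygx; rewrite -gyx gK // eqxx.
  by rewrite andbT; apply: contraNneq yx => gyx; rewrite -(gK y) // gyx gK ?mem_head.
- by move=> y /sub[ys _ _]; exact: gK.
- by move=> y z /sub[ys _ _] /sub[zs _ _]; exact: guniq.
Qed.

Lemma eq_sqrz_mod3 (a b : int) :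
  a * a = b * b -> (a %% 3)%Z = 1 -> (b %% 3)%Z = 1 -> a = b.
Proof.
move=> ab a3 b3; have /eqP : (a - b) * (a + b) = 0 by rewrite mulrDr !mulrBl ab; ring.
by rewrite mulf_eq0; lia.
Qed.

Lemma divz3_eq (a : int) r : (a %% 3)%Z = r -> a = 3 * (a %/ 3)%Z + r.
Proof. lia. Qed.

(** Modulo 3 the two sides are 2 and 1. *)
Lemma sqrz_neq_mul5 (a b : int) :
  (a %% 3)%Z = 1 -> (b %% 3)%Z = 1 -> 5 * (a * a) <> b * b.
Proof. by move=> /divz3_eq-> /divz3_eq->; lia. Qed.

(** * Representations by a^2 + 2 b^2 *)

(** For N divisible by 3 these congruences amount to a = b = 1 mod 6. The weaker form survives the
    descent from N to N / 9, which may be prime to 3. *)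
Definition rep2 (N : nat) (x : int * int) : bool :=
  [&& (x.1 %% 2)%Z == 1, (x.2 %% 2)%Z == 1, ((x.1 + x.2) %% 3)%Z == 2
    & x.1 * x.1 + 2 * (x.2 * x.2) == N%:Z].

Lemma rep2_mod3 N a b : rep2 N (a, b) ->
  if (3 %| N)%N then (a %% 3)%Z = 1 /\ (b %% 3)%Z = 1
  else (a %% 3)%Z = 0 /\ (b %% 3)%Z = 2 \/ (a %% 3)%Z = 2 /\ (b %% 3)%Z = 0.
Proof.
case/and4P => /= _ _ ab /eqP eqN.
have : [\/ (a %% 3)%Z = 0 /\ (b %% 3)%Z = 2, (a %% 3)%Z = 2 /\ (b %% 3)%Z = 0
         | (a %% 3)%Z = 1 /\ (b %% 3)%Z = 1].
  have [|[|]] : (a %% 3)%Z = 0 \/ (a %% 3)%Z = 1 \/ (a %% 3)%Z = 2 by lia.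
  - by constructor 1; lia.
  - by constructor 3; lia.
  - by constructor 2; lia.
by case=> -[a3 b3]; move: eqN; rewrite (divz3_eq a3) (divz3_eq b3) => eqN;
  case: ifP; lia.
Qed.

(** Exactly one coordinate is divisible by 3. Negating it keeps a + b mod 3 and has no fixed point,
    since the coordinate is odd and hence nonzero. *)
Lemma even_rep2_ndvd3 N (s : seq (int * int)) :
  ~~ (3 %| N)%N -> uniq s -> s =i rep2 N -> odd (size s) = false.
Proof.
move=> N3 us sP.
pose g (x : int * int) := if (x.1 %% 3)%Z == 0 then (- x.1, x.2) else (x.1, - x.2).
have nfix x : x \in s -> g x <> x.
  by case: x => a b; rewrite sP => /and4P[/= a2 b2 _ _]; rewrite /g /=;
    case: ifP => _ []; lia.
rewrite (@odd_size_involution _ s g) //.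
- by apply/hasP => -[x xs /eqP]; exact: nfix.
- case=> a b; rewrite sP => abP; have := rep2_mod3 abP; rewrite (negbTE N3).
  case/and4P: abP => /= a2 b2 ab eqN ab3; rewrite sP /g /=.
  case: ifP => a3; apply/and4P; split=> /=; rewrite ?mulrNN //; lia.
- case=> a b; rewrite sP => abP; have := rep2_mod3 abP; rewrite (negbTE N3).
  by move=> ab3; rewrite /g /=; case a3: ((a %% 3)%Z == 0) => /=;
    case: ifP => ?; congr pair; lia.
- by move=> x y xs _ /(nfix _ xs).
Qed.

(* The involution is conjugation of the quotient of [a + b sqrt(-2)] by
   [1 + sqrt(-2)], up to the sign that restores [a + b = 2 mod 3]. *)
Lemma odd_rep2_dvd3 N (s : seq (int * int)) :
    (3 %| N)%N -> ~~ (9 %| N)%N -> uniq s -> s =i rep2 N ->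
  odd (size s) <-> exists k, odd k /\ N = (3 * k ^ 2)%N.
Proof.
move=> N3 N9 us sP.
pose g (x : int * int) :=
  let a := ((4 * x.2 - x.1) %/ 3)%Z in let b := ((2 * x.1 + x.2) %/ 3)%Z in
  if ((a + b) %% 3)%Z == 2 then (a, b) else (- a, - b).
(* The last clause is the form that 9 not dividing N takes in u and v. It makes the new coordinate
   sum nonzero mod 3, so exactly one sign restores the residue 2. *)
have sE a b : (a, b) \in s -> exists u v,
    [/\ a = 3 * u + 1, b = 3 * v + 1, rep2 N (a, b) & ((u - v) %% 3)%Z <> 1].
  rewrite sP => abP; have := rep2_mod3 abP; rewrite N3 => -[a3 b3].
  exists (a %/ 3)%Z, (b %/ 3)%Z; split=> //; try exact: divz3_eq.
  case/and4P: abP => /= _ _ _; rewrite {1 2}(divz3_eq a3) {1 2}(divz3_eq b3).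
  by move: N9; lia.
have gE u v : g (3 * u + 1, 3 * v + 1) =
    let a := 4 * v - u + 1 in let b := 2 * u + v + 1 in
    if ((a + b) %% 3)%Z == 2 then (a, b) else (- a, - b).
  rewrite /g /=.
  have -> : ((4 * (3 * v + 1) - (3 * u + 1)) %/ 3)%Z = 4 * v - u + 1 by lia.
  by have -> : ((2 * (3 * u + 1) + (3 * v + 1)) %/ 3)%Z = 2 * u + v + 1 by lia.
(* The quotient is its own conjugate when a = b. The sign change could only fix a pair with a = -2
   b, which the oddness of a excludes. *)
have gfix a b : (a, b) \in s -> g (a, b) = (a, b) <-> a = b.
  case/sE => u [v [-> -> /and4P[/= a2 b2 _ _] uv]]; rewrite gE /=.
  by split; [case: ifP => _ []; lia | case: ifP => ? ?; congr pair; lia].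
rewrite (@odd_size_involution _ s g) //.
- split=> [/hasP[[a b] abs /eqP]|[k [k2 Nk]]].
    rewrite gfix // => eq_ab; move: abs; rewrite sP -eq_ab => /and4P[/= a2 _ _ eqN].
    by exists `|a|%N; split; [lia|nia].
  pose a := if (k%:Z %% 3)%Z == 1 then k%:Z else - k%:Z.
  have k3 : ~~ (3 %| k)%N.
    by apply: contra N9; rewrite Nk => k3; rewrite (@dvdn_mul 3 3) // dvdn_mulr.
  have aas : (a, a) \in s.
    rewrite sP; apply/and4P; rewrite /a /=; split.
    + by case: ifP; lia.
    + by case: ifP; lia.
    + by case: ifP; lia.
    + by rewrite Nk; case: ifP => _; lia.
  by apply/hasP; exists (a, a) => //; apply/eqP/gfix.
- case=> a b /[dup] /sE[u [v [-> -> /and4P[/= a2 b2 ab eqN] uv]]] _; rewrite sP gE /=.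
  by case: ifP => ab3; apply/and4P; split=> /=; lia.
- case=> a b /sE[u [v [-> -> /and4P[/= a2 b2 ab eqN] uv]]]; rewrite gE /=.
  by case: ifP => ab3; rewrite /g /=; case: ifP => ?; congr pair; lia.
case=> a b [c d] abs cds /gfix-/(_ abs) ab /gfix-/(_ cds) cd.
move: abs cds; rewrite -ab -cd !sP => aa cc.
have := rep2_mod3 aa; have := rep2_mod3 cc; rewrite N3 => -[c3 _] [a3 _].
have -> // : a = c; apply: eq_sqrz_mod3 => //.
by case/and4P: aa => /= _ _ _ eqa; case/and4P: cc => /= _ _ _; move: eqa; lia.
Qed.

(* When [9 | N], division by [(1 + sqrt(-2))^2 = -1 + 2 sqrt(-2)] descends to [N / 9]. *)
Lemma odd_rep2 N (s : seq (int * int)) :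
    uniq s -> s =i rep2 N ->
  odd (size s) <-> exists k, odd k /\ N = (3 * k ^ 2)%N.
Proof.
elim/ltn_ind: N s => N IH s us sP.
have [N3|N3] := boolP (3 %| N)%N; last first.
  rewrite (even_rep2_ndvd3 N3 us sP); split=> // -[k [_ Nk]].
  by move: N3; rewrite Nk dvdn_mulr.
have [/dvdnP[M NM]|N9] := boolP (9 %| N)%N; last exact: odd_rep2_dvd3.
(* The induction needs N / 9 < N, so N = 0 is treated apart; it has no representation with odd
   coordinates. *)
have [N0|N0] := posnP N.
  case: s us sP => [|[a b] s] us sP.
    by split=> // -[k []]; rewrite N0 => k2; nia.
  have := mem_head (a, b) s; rewrite sP => /and4P[/= a2 b2 _]; rewrite N0; nia.
pose h (x : int * int) := (((4 * x.2 - x.1) %/ 9)%Z, ((- 2 * x.1 - x.2) %/ 9)%Z).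
pose h' (x : int * int) := (- x.1 - 4 * x.2, 2 * x.1 - x.2).
(* With a = 3 u + 1 and b = 3 v + 1, divisibility of N by 9 says u = v + 1 mod 3, and this makes
   both divisions by 9 exact. *)
have hK : {in s, cancel h h'}.
  case=> x y; rewrite sP => xyP; have := rep2_mod3 xyP; rewrite N3 => -[x3 y3].
  case/and4P: xyP => /= x2 y2 _; move: (divz3_eq x3) (divz3_eq y3).
  move: (x %/ 3)%Z (y %/ 3)%Z => u v -> ->; rewrite NM => eqN.
  by rewrite /h /h' /=; congr pair; lia.
have h'K : cancel h' h by case=> e f; rewrite /h /h' /=; congr pair; lia.
have hs : [seq h x | x <- s] =i rep2 M.
  case=> e f; apply/mapP/idP => [[x xs hx]|efP].
    have := hK _ xs; rewrite -hx => /esym xE; move: xs; rewrite sP xE.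
    by case/and4P=> /= x2 y2 xy; rewrite NM => eqN; apply/and4P; split=> /=; lia.
  exists (h' (e, f)); last by rewrite h'K.
  rewrite sP; case/and4P: efP => /= e2 f2 ef eqM.
  by apply/and4P; split=> /=; lia.
have us' : uniq [seq h x | x <- s].
  by rewrite map_inj_in_uniq // => x y xs ys hxy; rewrite -(hK x) // hxy hK.
have := IH M _ _ us' hs; rewrite size_map => ->; last by lia.
split=> -[k [k2 Mk]]; first by exists (3 * k)%N; split; [lia|rewrite NM Mk; lia].
have /dvdnP[j kj] : (3 %| k)%N.
  have: (3 %| k ^ 2)%N by apply/dvdnP; exists M; lia.
  by rewrite Euclid_dvdX // => /andP[].
by exists j; split; [lia|rewrite kj in Mk; lia].
Qed.

(** * Representations by a^2 + 5 b^2 *)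

(** Multiplying a + b sqrt(-5) by 1 + sqrt(-5) gives coordinates a - 5 b and a + b, which agree mod
    6. One congruence on a + b therefore puts both in the class 1 mod 6. *)
Definition rep5 (N : nat) (x : int * int) : bool :=
  (((x.1 + x.2) %% 6)%Z == 1) && (x.1 * x.1 + 5 * (x.2 * x.2) == N%:Z).

Lemma rep5_mod3 N a b : rep5 N (a, b) ->
  if (3 %| N)%N then (a %% 3)%Z = 2 /\ (b %% 3)%Z = 2
  else (a %% 3)%Z = 0 /\ (b %% 3)%Z = 1 \/ (a %% 3)%Z = 1 /\ (b %% 3)%Z = 0.
Proof.
case/andP => /= ab /eqP eqN.
have : [\/ (a %% 3)%Z = 0 /\ (b %% 3)%Z = 1, (a %% 3)%Z = 1 /\ (b %% 3)%Z = 0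
         | (a %% 3)%Z = 2 /\ (b %% 3)%Z = 2].
  have [|[|]] : (a %% 3)%Z = 0 \/ (a %% 3)%Z = 1 \/ (a %% 3)%Z = 2 by lia.
  - by constructor 1; lia.
  - by constructor 2; lia.
  - by constructor 3; lia.
by case=> -[a3 b3]; move: eqN; rewrite (divz3_eq a3) (divz3_eq b3) => eqN;
  case: ifP; lia.
Qed.

(** Negating the coordinate divisible by 3 changes a + b by a multiple of 6. Fixed points have a
    zero coordinate, so N is 5 b^2 or a^2; both cannot occur, by reduction mod 3. *)
Lemma odd_rep5_ndvd3 N (s : seq (int * int)) :
    ~~ (3 %| N)%N -> uniq s -> s =i rep5 N ->
  odd (size s) <-> exists k, odd k /\ (N = k ^ 2 \/ N = 5 * k ^ 2)%N.
Proof.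
move=> N3 us sP.
pose g (x : int * int) := if (x.1 %% 3)%Z == 0 then (- x.1, x.2) else (x.1, - x.2).
have sE a b : (a, b) \in s -> rep5 N (a, b) /\
    ((a %% 3)%Z = 0 /\ (b %% 3)%Z = 1 \/ (a %% 3)%Z = 1 /\ (b %% 3)%Z = 0).
  by rewrite sP => abP; have := rep5_mod3 abP; rewrite (negbTE N3).
have gfix a b : (a, b) \in s -> g (a, b) = (a, b) <-> a = 0 \/ b = 0.
  move/sE=> [_ ab3]; rewrite /g /=.
  by case: ifP => a3; split=> [[]|?]; try congr pair; lia.
rewrite (@odd_size_involution _ s g) //.
- split=> [/hasP[[a b] abs /eqP]|[k [k2 Nk]]].
    rewrite gfix // => ab0; move: abs; rewrite sP => /andP[/= ab eqN].
    case: ab0 => ab0; move: ab eqN; rewrite ab0 => ab eqN.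
      by exists `|b|%N; split; [lia|right; nia].
    by exists `|a|%N; split; [lia|left; nia].
  pose a := if (k%:Z %% 3)%Z == 1 then k%:Z else - k%:Z.
  have k3 : ~~ (3 %| k)%N.
    by apply: contra N3 => k3; case: Nk => ->; rewrite ?dvdn_mull // Euclid_dvdX // k3.
  have a1 : (a %% 6)%Z = 1 by rewrite /a; case: ifP; lia.
  have aa : a * a = k%:Z * k%:Z by rewrite /a; case: ifP => _; ring.
  have abs : if (N == k ^ 2)%N then (a, 0) \in s else (0, a) \in s.
    by case: ifP => Nk'; rewrite sP; apply/andP; split=> /=; lia.
  move: abs; case: ifP => _ abs; apply/hasP.
    by exists (a, 0) => //; apply/eqP/gfix => //; right.
  by exists (0, a) => //; apply/eqP/gfix => //; left.
- case=> a b /sE[/andP[/= ab eqN] ab3]; rewrite sP /g /=.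
  by case: ifP => a3; apply/andP; split=> /=; rewrite ?mulrNN //; lia.
- case=> a b /sE[_ ab3]; rewrite /g /=; case a3: ((a %% 3)%Z == 0) => /=.
    by case: ifP => ?; congr pair; lia.
  by case: ifP => ?; congr pair; lia.
case=> a b [c d] abs cds /gfix-/(_ abs) ab /gfix-/(_ cds) cd.
have [/andP[/= ab6 Nab] ab3] := sE _ _ abs; have [/andP[/= cd6 Ncd] cd3] := sE _ _ cds.
case: ab ab3 Nab => -> ab3; case: cd cd3 Ncd => -> cd3 Ncd Nab.
- by congr pair; apply: eq_sqrz_mod3; lia.
- by have := @sqrz_neq_mul5 b c; lia.
- by have := @sqrz_neq_mul5 d a; lia.
- by congr pair; apply: eq_sqrz_mod3; lia.
Qed.

(* The involution sends [z = a + b sqrt(-5)] to [conj z * (2 - sqrt(-5)) / 3], up to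
   the sign that restores [a + b = 1 mod 6]. *)
Lemma even_rep5_dvd3 N (s : seq (int * int)) :
    (3 %| N)%N -> ~~ (9 %| N)%N -> uniq s -> s =i rep5 N -> odd (size s) = false.
Proof.
move=> N3 N9 us sP.
pose g (x : int * int) :=
  let a := ((2 * x.1 - 5 * x.2) %/ 3)%Z in let b := ((- x.1 - 2 * x.2) %/ 3)%Z in
  if ((a + b) %% 3)%Z == 1 then (a, b) else (- a, - b).
have sE a b : (a, b) \in s -> exists u v,
    [/\ a = 3 * u + 2, b = 3 * v + 2, rep5 N (a, b) & ((u - v) %% 3)%Z <> 1].
  rewrite sP => abP; have := rep5_mod3 abP; rewrite N3 => -[a3 b3].
  exists (a %/ 3)%Z, (b %/ 3)%Z; split=> //; try exact: divz3_eq.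
  case/andP: abP => /= _; rewrite {1 2}(divz3_eq a3) {1 2}(divz3_eq b3).
  by move: N9; lia.
have gE u v : g (3 * u + 2, 3 * v + 2) =
    let a := 2 * u - 5 * v - 2 in let b := - u - 2 * v - 2 in
    if ((a + b) %% 3)%Z == 1 then (a, b) else (- a, - b).
  rewrite /g /=.
  have -> : ((2 * (3 * u + 2) - 5 * (3 * v + 2)) %/ 3)%Z = 2 * u - 5 * v - 2 by lia.
  by have -> : ((- (3 * u + 2) - 2 * (3 * v + 2)) %/ 3)%Z = - u - 2 * v - 2 by lia.
(* A fixed point would have a = b or a = -5 b, making a + b even. *)
have nfix x : x \in s -> g x <> x.
  case: x => a b /sE[u [v [-> -> /andP[/= ab eqN] uv]]]; rewrite gE /=.
  by case: ifP => _ []; lia.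
rewrite (@odd_size_involution _ s g) //.
- by apply/hasP => -[x xs /eqP]; exact: nfix.
- case=> a b /sE[u [v [-> -> /andP[/= ab eqN] uv]]]; rewrite sP gE /=.
  (* Since a + b is odd, so is u - v; this yields the parity of the new coordinate sum. *)
  have uE : u = v + 1 + 2 * ((u - v - 1) %/ 2)%Z by lia.
  case: ifP => ab3; apply/andP; split=> /=; try lia;
    by move: uv ab3; rewrite {ab eqN} uE; move: (_ %/ 2)%Z => w; lia.
- case=> a b /sE[u [v [-> -> /andP[/= ab eqN] uv]]]; rewrite gE /=.
  by case: ifP => ab3; rewrite /g /=; case: ifP => ?; congr pair; lia.
- by move=> x y xs _ /(nfix _ xs).
Qed.

(* When [9 | N], division by [2 - sqrt(-5)] descends to [N / 9]. *)
Lemma odd_rep5 N (s : seq (int * int)) :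
    uniq s -> s =i rep5 N ->
  odd (size s) <-> exists k, odd k /\ (N = k ^ 2 \/ N = 5 * k ^ 2)%N.
Proof.
elim/ltn_ind: N s => N IH s us sP.
have [N3|N3] := boolP (3 %| N)%N; last exact: odd_rep5_ndvd3.
have dvd3 k : (N = k ^ 2 \/ N = 5 * k ^ 2)%N -> (3 %| k)%N.
  by case=> Nk; move: N3; rewrite Nk 1?(Euclid_dvdM 5) // Euclid_dvdX // => /andP[].
have [/dvdnP[M NM]|N9] := boolP (9 %| N)%N; last first.
  rewrite (even_rep5_dvd3 N3 N9 us sP); split=> // -[k [_ /[dup] /dvd3 k3 Nk]].
  have k9 : (9 %| k ^ 2)%N by exact: (@dvdn_mul 3 3).
  by move: N9; case: Nk => ->; rewrite ?k9 // dvdn_mull.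
have [N0|N0] := posnP N.
  case: s us sP => [|[a b] s] us sP.
    by split=> // -[k []]; rewrite N0 => k2; nia.
  have := mem_head (a, b) s; rewrite sP => /andP[/= ab]; rewrite N0; nia.
pose h (x : int * int) := (((2 * x.1 - 5 * x.2) %/ 9)%Z, ((x.1 + 2 * x.2) %/ 9)%Z).
pose h' (x : int * int) := (2 * x.1 + 5 * x.2, 2 * x.2 - x.1).
have hK : {in s, cancel h h'}.
  case=> x y; rewrite sP => xyP; have := rep5_mod3 xyP; rewrite N3 => -[x3 y3].
  case/andP: xyP => /= _; move: (divz3_eq x3) (divz3_eq y3).
  move: (x %/ 3)%Z (y %/ 3)%Z => u v -> ->; rewrite NM => eqN.
  by rewrite /h /h' /=; congr pair; lia.
have h'K : cancel h' h by case=> e f; rewrite /h /h' /=; congr pair; lia.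
have hs : [seq h x | x <- s] =i rep5 M.
  case=> e f; apply/mapP/idP => [[x xs hx]|efP].
    have := hK _ xs; rewrite -hx => /esym xE; move: xs; rewrite sP xE.
    by case/andP=> /= xy; rewrite NM => eqN; apply/andP; split=> /=; lia.
  exists (h' (e, f)); last by rewrite h'K.
  rewrite sP; case/andP: efP => /= ef eqM.
  by apply/andP; split=> /=; lia.
have us' : uniq [seq h x | x <- s].
  by rewrite map_inj_in_uniq // => x y xs ys hxy; rewrite -(hK x) // hxy hK.
have := IH M _ _ us' hs; rewrite size_map => ->; last by lia.
split=> -[k [k2 Mk]]; first by exists (3 * k)%N; split; [lia|rewrite NM; lia].
have /dvdnP[j kj] := dvd3 _ Mk.
by exists j; split; [lia|rewrite kj in Mk; lia].
Qed.

(** * Power series: substitution of x^p, sections and lowest terms *)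

Lemma fps_coefM (R : comNzRingType) (f g : fps R) n :
  (f * g) n = \sum_(i < n.+1) f i * g (n - i)%N.
Proof. by []. Qed.

Lemma fps_coefD (R : zmodType) (f g : fps R) n : (f + g) n = f n + g n.
Proof. by []. Qed.

Section ExpandSection.
Variables (R : comNzRingType) (p : nat).
Hypothesis p_gt0 : (0 < p)%N.
Implicit Types f g : fps R.

Definition fps_expand f : fps R :=
  Fps (fun n => if (p %| n)%N then f (n %/ p)%N else 0).

Lemma fps_coef_expand f n :
  fps_expand f n = if (p %| n)%N then f (n %/ p)%N else 0.
Proof. by []. Qed.

Definition fps_section f : fps R := Fps (fun n => f (p * n)%N).

(** Only the indices i = p j contribute. This form yields both the multiplicativity of [fps_expand]
    and the projection formula [fps_section_expandM]. *)
Lemma fps_coef_expandM f g n :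
  (fps_expand f * g) n = \sum_(j < (n %/ p).+1) f j * g (n - p * j)%N.
Proof.
rewrite fps_coefM (eq_bigr (fun i : 'I_n.+1 =>
  if (p %| i)%N then f (i %/ p)%N * g (n - i)%N else 0)); last first.
  by move=> i _ /=; case: ifP; rewrite ?mul0r.
rewrite -big_mkcond /=.
have lt1 (j : 'I_(n %/ p).+1) : (p * j < n.+1)%N.
  by have := ltn_ord j; rewrite !ltnS leq_divRL // mulnC.
have lt2 (i : 'I_n.+1) : (i %/ p < (n %/ p).+1)%N.
  by rewrite ltnS leq_div2r // -ltnS.
rewrite (reindex_onto (fun j => Ordinal (lt1 j)) (fun i => Ordinal (lt2 i))) /=; last first.
  by move=> i pi; apply: val_inj; rewrite /= mulnC divnK.
apply: eq_big => [j|j _]; last by rewrite mulKn.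
by rewrite dvdn_mulr //=; apply/eqP/val_inj; rewrite /= mulKn.
Qed.

Lemma fps_expandD f g : fps_expand (f + g) = fps_expand f + fps_expand g.
Proof. by apply: fpsP => n /=; case: ifP; rewrite ?addr0. Qed.

Lemma fps_expandM f g : fps_expand (f * g) = fps_expand f * fps_expand g.
Proof.
apply: fpsP => n; rewrite fps_coef_expandM /=.
case: (boolP (p %| n)%N) => pn.
  apply: eq_bigr => j _; rewrite dvdn_subl ?dvdn_mulr //; last first.
    by have := ltn_ord j; rewrite ltnS leq_divRL // mulnC.
  by rewrite pn [(p * j)%N]mulnC divnBMl.
rewrite big1 // => j _; rewrite dvdn_subl ?(negbTE pn) ?mulr0 ?dvdn_mulr //.
by have := ltn_ord j; rewrite ltnS leq_divRL // mulnC.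
Qed.

Lemma fps_expand1 : fps_expand 1 = 1.
Proof.
apply: fpsP => n /=; case: ifP => [/dvdnP[k ->]|].
  by rewrite mulnK // muln_eq0 (gtn_eqF p_gt0) orbF.
by case: n => [|n] //; rewrite dvdn0.
Qed.

Lemma fps_expandX f k : fps_expand (f ^+ k) = fps_expand f ^+ k.
Proof.
by elim: k => [|k IH]; rewrite ?expr0 ?fps_expand1 // !exprS fps_expandM IH.
Qed.

Lemma fps_sectionD f g : fps_section (f + g) = fps_section f + fps_section g.
Proof. exact: fpsP. Qed.

(** Projection formula: U is linear over the series in x^p. *)
Lemma fps_section_expandM f g : fps_section (fps_expand f * g) = f * fps_section g.
Proof.
apply: fpsP => n; rewrite /= -[LHS]/((fps_expand f * g) (p * n)%N) fps_coef_expandM mulKn //.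
by apply: eq_bigr => j _; rewrite mulnBr.
Qed.

End ExpandSection.

Lemma fps_mul_lead (R : comNzRingType) (f g : fps R) m n :
    (forall i, (i < m)%N -> f i = 0) -> (forall i, (i < n)%N -> g i = 0) ->
  (forall i, (i < m + n)%N -> (f * g) i = 0) /\ (f * g) (m + n)%N = f m * g n.
Proof.
move=> fm gn; split=> [i lti|].
  rewrite fps_coefM big1 // => j _; have [/fm->|mj] := ltnP j m; first by rewrite mul0r.
  by rewrite gn ?mulr0 //; have := ltn_ord j; lia.
have ltm : (m < (m + n).+1)%N by lia.
rewrite fps_coefM (bigD1 (Ordinal ltm)) //= addKn big1 ?addr0 // => j.
rewrite -val_eqE /= => neqj.
have [/fm->|mj] := ltnP j m; first by rewrite mul0r.
by rewrite gn ?mulr0 //; have := ltn_ord j; lia.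
Qed.

Lemma fps_order (R : comNzRingType) (f : fps R) :
  f <> 0 -> exists n, f n <> 0 /\ forall i, (i < n)%N -> f i = 0.
Proof.
move=> f0; have /existsNP[n] : ~ forall n, f n = 0.
  by move=> all0; apply: f0; apply: fpsP.
elim/ltn_ind: n => n IH fn.
have [|/existsNP[i /not_implyP[lti fi]]] := pselect (forall i, (i < n)%N -> f i = 0).
  by exists n.
exact: (IH i).
Qed.

Lemma fps_mulf_eq0 (R : idomainType) (f g : fps R) : f * g = 0 -> f = 0 \/ g = 0.
Proof.
move=> fg; have [->|/fps_order[m [fm fm']]] := pselect (f = 0); first by left.
right; apply/not_notP => /fps_order[n [gn gn']].
have [_] := fps_mul_lead fm' gn'; rewrite fg => /esym/eqP.
by rewrite mulf_eq0 => /orP[]/eqP.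
Qed.

(** * Squaring modulo 2 *)

Lemma F2E (x : 'F_2) : x = (x != 0)%:R.
Proof. by apply/eqP; case: x => [[|[|]]]. Qed.

Lemma natr_F2 n : n%:R = (odd n)%:R :> 'F_2.
Proof. by rewrite -Fp_nat_mod // modn2. Qed.

Lemma F2_addrr (x : 'F_2) : x + x = 0.
Proof. by apply/eqP; case: x => [[|[|]]]. Qed.

Lemma fps_addrr (f : fps 'F_2) : f + f = 0.
Proof. by apply: fpsP => n; rewrite fps_coefD F2_addrr. Qed.

(** The terms at i and n - i cancel, leaving only a middle term when n is even. Applied to a Cauchy
    square, this gives the Frobenius identity. *)
Lemma sum_palindrome_F2 n (F : nat -> 'F_2) :
    (forall i, (i <= n)%N -> F (n - i)%N = F i) ->
  \sum_(i < n.+1) F i = if odd n then 0 else F n./2.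
Proof.
elim/ltn_ind: n F => -[|[|n]] IH F Fsym.
- by rewrite big_ord1.
- by rewrite !big_ord_recl big_ord0 addr0 -(Fsym 1%N) //= F2_addrr.
- rewrite big_ord_recr big_ord_recl /= (Fsym 0%N) // addrAC F2_addrr add0r.
  have Fsym' i : (i <= n)%N -> F (n - i).+1 = F i.+1.
    by move=> lei; rewrite -[RHS]Fsym; [congr F; lia | lia].
  by rewrite (IH n _ (fun i => F i.+1)) ?negbK //; lia.
Qed.

Lemma fps_sqr_F2 (f : fps 'F_2) : f ^+ 2 = fps_expand 2 f.
Proof.
apply: fpsP => n; rewrite expr2 fps_coefM.
rewrite (sum_palindrome_F2 (F := fun i => f i * f (n - i)%N)).
  rewrite /= dvdn2 -divn2; case: (boolP (odd n)) => //= n2.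
  have -> : (n - n %/ 2 = n %/ 2)%N by lia.
  by move: (f _) => x; apply/eqP; case: x => [[|[|]]].
by move=> i lei; rewrite subKn // mulrC.
Qed.

(** * Coefficients of D and the modular equation of degree 5 *)

(** For k prime to 6 exactly one of k and -k is 1 mod 6. Signed roots turn coprimality into a
    congruence and make the root of each square unique. *)
Lemma coef_DP n :
  D n = `[< exists k : int, (k %% 6)%Z = 1 /\ k * k = n%:Z >]%:R.
Proof.
rewrite /D /=; congr (nat_of_bool _)%:R; apply: asbool_equiv_eq; split.
  case=> k [k0 k6 ->].
  have : ~~ (2 %| k)%N /\ ~~ (3 %| k)%N.
    by split; apply/negP => dk; [move: (dvdn_gcd 2 k 6)|move: (dvdn_gcd 3 k 6)];
      rewrite k6 dk.
  move=> [k2 k3]; exists (if (k %% 6 == 1)%N then k%:Z else - k%:Z).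
  by case: ifP => k1; split; lia.
case=> k [k6 kn]; exists `|k|%N; split; [lia| |lia].
have -> : gcdn `|k| 6 = gcdn (`|k| %% 6) 6 by rewrite gcdn_modl.
by have [->|->] : (`|k| %% 6 = 1)%N \/ (`|k| %% 6 = 5)%N by lia.
Qed.

Definition rep (m N : nat) (x : int * int) : bool :=
  [&& (x.1 %% 6)%Z == 1, (x.2 %% 6)%Z == 1
    & x.1 * x.1 + m%:Z * (x.2 * x.2) == N%:Z].

Lemma eq_sqrz_mod6 (a b : int) :
  a * a = b * b -> (a %% 6)%Z = 1 -> (b %% 6)%Z = 1 -> a = b.
Proof. by move=> ab a6 b6; apply: eq_sqrz_mod3 => //; lia. Qed.

(** Nonzero terms of the Cauchy product are the splittings N = i + m j with i and j in the support
    of D. Uniqueness of the roots that are 1 mod 6 matches them with the pairs in [rep m N]. *)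
Lemma coef_D_mul_expand m N : (0 < m)%N ->
  exists s, [/\ uniq s, s =i rep m N & (D * fps_expand m D) N = (odd (size s))%:R].
Proof.
move=> m0.
(* [r n] is the root of n that is 1 mod 6; its value is irrelevant outside the support of D. *)
have /choice[r rP] : forall n, exists k : int,
    D n != 0 -> (k %% 6)%Z = 1 /\ k * k = n%:Z.
  move=> n; rewrite coef_DP; case: asboolP => [[k kP]|_]; first by exists k.
  by exists 0; rewrite eqxx.
have Dsqr (k : int) n : (k %% 6)%Z = 1 -> k * k = n%:Z -> (D n != 0) /\ r n = k.
  move=> k6 kn; have Dn : D n != 0.
    by rewrite coef_DP asboolT ?oner_neq0 //; exists k.
  by split=> //; have [r6 rn] := rP _ Dn; apply: eq_sqrz_mod6; rewrite ?rn.
pose P i := (D i != 0) && (fps_expand m D (N - i)%N != 0).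
pose s := [seq i <- iota 0 N.+1 | P i].
have sP i : i \in s -> exists j, [/\ N = (i + m * j)%N, D i != 0 & D j != 0].
  rewrite mem_filter mem_iota add0n ltnS => /andP[/andP[Di /=]].
  case: ifP => [/dvdnP[j Nij]|_]; last by rewrite eqxx.
  by rewrite Nij mulnK // => Dj leiN; exists j; split=> //; lia.
pose h i := (r i, r ((N - i) %/ m)%N).
exists [seq h i | i <- s]; split.
- rewrite map_inj_in_uniq ?filter_uniq ?iota_uniq // => i j /sP[_ [_ Di _]] /sP[_ [_ Dj _]].
  case=> rij _; have [_ ri] := rP _ Di; have [_ rj] := rP _ Dj.
  by move: ri; rewrite rij rj; lia.
- case=> a b; apply/mapP/idP =>
    [[i /sP[j [NE Di Dj]] [-> ->]]|/and3P[/= /eqP a6 /eqP b6 /eqP abN]].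
    have -> : ((N - i) %/ m = j)%N by rewrite NE addKn mulKn.
    have [ri6 ri] := rP _ Di; have [rj6 rj] := rP _ Dj.
    by apply/and3P; rewrite /= ri6 rj6 ri rj; split=> //; lia.
  have [Di ri] := Dsqr a (`|a| * `|a|)%N a6 ltac:(lia).
  have [Dj rj] := Dsqr b (`|b| * `|b|)%N b6 ltac:(lia).
  have NE : (N = `|a| * `|a| + m * (`|b| * `|b|))%N by lia.
  exists (`|a| * `|a|)%N; last by rewrite /h {1}NE addKn mulKn // ri rj.
  rewrite mem_filter mem_iota /P Di NE addKn /= dvdn_mulr // mulKn // Dj /=; lia.
rewrite size_map fps_coefM.
rewrite (eq_bigr (fun i : 'I_N.+1 => (nat_of_bool (P i))%:R)) => [|i _]; last first.
  by rewrite [in LHS](F2E (D i)) [X in _ * X]F2E /P -natrM mulnb.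
rewrite -natr_sum natr_F2; congr (nat_of_bool (odd _))%:R.
rewrite -(big_mkord xpredT (fun i => nat_of_bool (P i))) /index_iota subn0.
by rewrite size_filter -sum1_count [RHS]big_mkcond.
Qed.

(** If a = b = 1 mod 3 then 3 divides a^2 + 2 b^2, so other N have no representation. When 3 divides
    N, [rep 2 N] and [rep2 N] coincide. *)
Lemma coef_D3 N : (D ^+ 3) N = `[< exists k, odd k /\ N = (3 * k ^ 2)%N >]%:R.
Proof.
rewrite exprS fps_sqr_F2; have [s [us sP ->]] := @coef_D_mul_expand 2 N isT.
suff os : odd (size s) <-> exists k, odd k /\ N = (3 * k ^ 2)%N.
  by congr (nat_of_bool _)%:R; apply/idP/asboolP => /os.
have rep_mod6 a b : rep 2 N (a, b) -> exists u v,
    [/\ a = 6 * u + 1, b = 6 * v + 1 & (6 * u + 1) * (6 * u + 1)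
        + 2 * ((6 * v + 1) * (6 * v + 1)) == N%:Z].
  case/and3P => /= a6 b6 eqN; exists (a %/ 6)%Z, (b %/ 6)%Z.
  have aE : a = 6 * (a %/ 6)%Z + 1 by lia.
  have bE : b = 6 * (b %/ 6)%Z + 1 by lia.
  by rewrite -aE -bE.
have [N3|N3] := boolP (3 %| N)%N.
  apply: odd_rep2 => // -[a b]; rewrite sP; apply/idP/idP.
    by move/rep_mod6=> [u [v [-> -> eqN]]]; apply/and4P; split=> //=; lia.
  move=> abP; have := rep2_mod3 abP; rewrite N3 => -[a3 b3].
  by case/and4P: abP => /= a2 b2 _ eqN; apply/and3P; split=> //=; lia.
case: s us sP => [|[a b] s] _ sP.
  by split=> // -[k [_ Nk]]; rewrite Nk dvdn_mulr in N3.
have := mem_head (a, b) s; rewrite sP => /rep_mod6[u [v [_ _ eqN]]].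
by move: N3 eqN; lia.
Qed.

(* [a + b sqrt(-5)] with [a = b = 1 mod 6] is divided by [1 + sqrt(-5)], of norm 6. *)
Lemma coef_D_mul_expand5 N : (D * fps_expand 5 D) N =
  `[< exists k, odd k /\ (N = 6 * k ^ 2 \/ N = 30 * k ^ 2)%N >]%:R.
Proof.
have [s [us sP ->]] := @coef_D_mul_expand 5 N isT.
suff os : odd (size s) <-> exists k, odd k /\ (N = 6 * k ^ 2 \/ N = 30 * k ^ 2)%N.
  by congr (nat_of_bool _)%:R; apply/idP/asboolP => /os.
pose h (x : int * int) := (((x.1 + 5 * x.2) %/ 6)%Z, ((x.2 - x.1) %/ 6)%Z).
pose h' (x : int * int) := (x.1 - 5 * x.2, x.1 + x.2).
have sE a b : (a, b) \in s -> exists u v,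
    [/\ a = 6 * u + 1, b = 6 * v + 1 & (6 * u + 1) * (6 * u + 1)
        + 5 * ((6 * v + 1) * (6 * v + 1)) == N%:Z].
  rewrite sP; case/and3P => /= a6 b6 eqN; exists (a %/ 6)%Z, (b %/ 6)%Z.
  have aE : a = 6 * (a %/ 6)%Z + 1 by lia.
  have bE : b = 6 * (b %/ 6)%Z + 1 by lia.
  by rewrite -aE -bE.
have [/dvdnP[M NM]|N6] := boolP (6 %| N)%N; last first.
  case: s us sP sE => [|[a b] s] _ _ sE.
    split=> // -[k [_ Nk]]; move: N6.
    by case: Nk => ->; rewrite ?dvdn_mulr // (@dvdn_mulr 6 30).
  have [u [v [_ _ eqN]]] := sE _ _ (mem_head (a, b) s).
  by move: N6 eqN; lia.
have hK : {in s, cancel h h'}.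
  by case=> a b /sE[u [v [-> -> _]]]; rewrite /h /h' /=; congr pair; lia.
have h'K : cancel h' h by case=> c d; rewrite /h /h' /=; congr pair; lia.
have us' : uniq [seq h x | x <- s].
  by rewrite map_inj_in_uniq // => x y xs ys hxy; rewrite -(hK x) // hxy hK.
have hs : [seq h x | x <- s] =i rep5 M.
  case=> c d; apply/mapP/idP => [[x xs hx]|/andP[/= cd eqM]].
    have := hK _ xs; rewrite -hx => /esym xE; move: xs; rewrite sP xE.
    by case/and3P=> /= a6 b6; rewrite NM => eqN; apply/andP; split=> /=; lia.
  exists (h' (c, d)); last by rewrite h'K.
  by rewrite sP; apply/and3P; split=> /=; lia.
have := odd_rep5 us' hs; rewrite size_map => ->.
by split=> -[k [k2 Nk]]; exists k; split=> //; lia.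
Qed.

Lemma coef_D6 N : (D ^+ 6) N = `[< exists k, odd k /\ N = (6 * k ^ 2)%N >]%:R.
Proof.
rewrite (exprM D 3 2) fps_sqr_F2 fps_coef_expand coef_D3.
case: (boolP (2 %| N)%N) => [N2|N2].
  by congr (nat_of_bool _)%:R; apply: asbool_equiv_eq; split=> -[k [k2 Nk]];
    exists k; split=> //; lia.
by rewrite asboolF // => -[k [_ Nk]]; move: N2; rewrite Nk; lia.
Qed.

(** The 5-adic valuation is even on the left and odd on the right. Hence the exponents 6 k^2 and 30
    j^2 never meet, and nothing cancels in D^6 + C^6. *)
Lemma sqrn_neq_mul5 k j : (0 < k)%N -> (k ^ 2 <> 5 * j ^ 2)%N.
Proof.
move=> k0 kj; have j0 : (0 < j)%N by case: j kj => // kj; nia.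
have := congr1 (logn 5) kj; rewrite lognM ?expn_gt0 ?j0 // !lognX (_ : logn 5 5 = 1%N) //.
lia.
Qed.

Lemma D6_relation : D ^+ 6 + fps_expand 5 D ^+ 6 = D * fps_expand 5 D.
Proof.
apply: fpsP => N; rewrite coef_D_mul_expand5 -fps_expandX // fps_coefD coef_D6.
have -> : fps_expand 5 (D ^+ 6) N = `[< exists k, odd k /\ N = (30 * k ^ 2)%N >]%:R.
  rewrite fps_coef_expand coef_D6; case: (boolP (5 %| N)%N) => [N5|N5].
    by congr (nat_of_bool _)%:R; apply: asbool_equiv_eq; split=> -[k [k2 Nk]];
      exists k; split=> //; lia.
  by rewrite asboolF // => -[k [_ Nk]]; move: N5; rewrite Nk; lia.
case: asboolP => [[k [k2 Nk]]|n6]; case: asboolP => [[j [j2 Nj]]|n30].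
- by exfalso; apply: (@sqrn_neq_mul5 k j); lia.
- by rewrite addr0 asboolT //; exists k; split=> //; left.
- by rewrite add0r asboolT //; exists j; split=> //; right.
- rewrite addr0 asboolF // => -[k [k2 [] Nk]]; first by apply: n6; exists k.
  by apply: n30; exists k.
Qed.

(** * The operator T_5 on powers of D *)

Lemma T_section_expand p f : T p f = fps_section p f + fps_expand p f.
Proof. exact: fpsP. Qed.

Lemma T_is_additive p : {morph T p : f g / f + g}.
Proof.
by move=> f g; rewrite !T_section_expand fps_sectionD fps_expandD addrACA.
Qed.

Lemma T_scale p (a : 'F_2) f : T p (a *: f) = a *: T p f.
Proof. by apply: fpsP => n /=; rewrite mulrDr; case: ifP; rewrite ?mulr0. Qed.

Lemma T_sub p f g : T p (f - g) = T p f - T p g.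
Proof. by rewrite -scaleN1r T_is_additive T_scale scaleN1r. Qed.

Lemma T_sum p n (F : 'I_n -> fps 'F_2) : T p (\sum_(i < n) F i) = \sum_(i < n) T p (F i).
Proof.
elim: n F => [|n IH] F; last by rewrite !big_ord_recr T_is_additive IH.
by rewrite !big_ord0 -(scale0r 1) T_scale !scale0r.
Qed.

(** Squaring is the substitution of x^2, which commutes with U and V because 2 and 5 are coprime. *)
Lemma T5_sqr f : T 5 (f ^+ 2) = T 5 f ^+ 2.
Proof.
rewrite !fps_sqr_F2; apply: fpsP => n /=.
case: (boolP (2 %| n)%N) => [/dvdnP[k ->]|n2].
  rewrite mulnA dvdn_mull // !mulnK // Euclid_dvdM // orbF.
  case: (boolP (5 %| k)%N) => [/dvdnP[j ->]|//].
  by rewrite mulnAC !mulnK // dvdn_mull.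
rewrite Euclid_dvdM // (negbTE n2) /= add0r; case: ifP => // n5.
by case: ifP => // n52; exfalso; move: n2 n5 n52; lia.
Qed.

(** The modular equation is symmetric in C and D. For V it is read as C^6 = D C + D^6; for U as D^6
    = C D + C^6, where the powers of C leave U as powers of D. *)
Lemma T5_D_recurrence n :
  T 5 (D ^+ (n + 6)) = D * T 5 (D ^+ n.+1) + D ^+ 6 * T 5 (D ^+ n).
Proof.
rewrite !T_section_expand.
have -> : fps_expand 5 (D ^+ (n + 6)) =
    D * fps_expand 5 (D ^+ n.+1) + D ^+ 6 * fps_expand 5 (D ^+ n).
  have C6 : fps_expand 5 D ^+ 6 = D * fps_expand 5 D + D ^+ 6.
    by rewrite -D6_relation addrAC fps_addrr add0r.
  by rewrite !fps_expandX // exprD C6 [_ ^+ n.+1]exprS; ring.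
have -> : fps_section 5 (D ^+ (n + 6)) =
    D * fps_section 5 (D ^+ n.+1) + D ^+ 6 * fps_section 5 (D ^+ n).
  rewrite -!fps_section_expandM // -fps_sectionD; congr fps_section.
  have D6 : D ^+ 6 = fps_expand 5 D * D + fps_expand 5 D ^+ 6.
    by rewrite [X in X + _]mulrC -D6_relation -addrA fps_addrr addr0.
  by rewrite fps_expandX // exprD D6 [D ^+ n.+1]exprS; ring.
by rewrite !mulrDr; ring.
Qed.

Lemma D_lead k : (forall i, (i < k)%N -> (D ^+ k) i = 0) /\ (D ^+ k) k = 1.
Proof.
have D0 : D 0 = 0 by rewrite coef_DP asboolF // => -[a [a6 a0]]; nia.
have D1 : D 1 = 1 by rewrite coef_DP asboolT //; exists 1.
elim: k => [|k [IH0 IH1]]; first by [].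
have D0' i : (i < 1)%N -> D i = 0 by case: i.
by have [] := fps_mul_lead D0' IH0; rewrite exprS add1n IH1 D1 mulr1.
Qed.

Lemma DX_neq0 k : D ^+ k <> 0.
Proof.
move/(congr1 (fun f : fps 'F_2 => f k)); rewrite (D_lead k).2 => /eqP.
by rewrite oner_eq0.
Qed.

(** If 5 n = k^2 then k = 5 j and n = 5 j^2, with j prime to 6 exactly when k is. So U D = V D, and
    they cancel mod 2. *)
Lemma T5_D : T 5 D = 0.
Proof.
rewrite T_section_expand -[RHS](fps_addrr (fps_expand 5 D)); congr (_ + _).
apply: fpsP => n; rewrite fps_coef_expand /fps_section /=.
have D5 : (exists k, [/\ (0 < k)%N, gcdn k 6 = 1%N & (5 * n = k ^ 2)%N]) <->
    exists j, [/\ (0 < j)%N, gcdn j 6 = 1%N & n = (5 * j ^ 2)%N].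
  split=> [[k [k0 k6 nk]]|[j [j0 j6 ->]]].
    have /dvdnP[j kj] : (5 %| k)%N.
      have : (5 %| k ^ 2)%N by rewrite -nk dvdn_mulr.
      by rewrite Euclid_dvdX // => /andP[].
    exists j; split; [lia| |by move: nk; rewrite kj; lia].
    by move/eqP: k6; rewrite kj -/(coprime _ _) coprimeMl => /andP[/eqP].
  exists (5 * j)%N; split; [lia| |lia].
  by apply/eqP; rewrite -/(coprime _ _) coprimeMl; apply/andP; split=> //; apply/eqP.
rewrite (asbool_equiv_eq D5); case: ifP => n5.
  congr (nat_of_bool _)%:R; apply: asbool_equiv_eq.
  by split=> -[j [j0 j6 nj]]; exists j; split=> //; lia.
by rewrite asboolF // => -[j [_ _ nj]]; move: n5; rewrite nj dvdn_mulr.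
Qed.

Lemma T5_1 : T 5 1 = 0.
Proof.
rewrite T_section_expand fps_expand1 // -[RHS](fps_addrr 1); congr (_ + _).
by apply: fpsP => n /=; rewrite muln_eq0.
Qed.

Lemma T5_DX_small k : (k < 5)%N -> T 5 (D ^+ k) = 0.
Proof.
have T2 : T 5 (D ^+ 2) = 0 by rewrite T5_sqr T5_D expr0n.
case: k => [|[|[|[|[|k]]]]] // _; rewrite ?expr0 ?expr1 ?T5_1 ?T5_D //.
  (* The case k = 3: D^6 is the square of D^3, and there are no zero divisors. *)
  have : T 5 (D ^+ (0 + 6)) = 0.
    by rewrite T5_D_recurrence expr1 expr0 T5_D T5_1 !mulr0 addr0.
  by rewrite add0n (exprM D 3 2) T5_sqr expr2 => /fps_mulf_eq0[].
by rewrite (exprM D 2 2) T5_sqr T2 expr0n.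
Qed.

(* The sixth-order recurrence and the Frobenius give
   T(D^5)^2 = T(D^10) = D T(D^5), so T(D^5) is 0 or D. *)
Lemma T5_D5 : T 5 (D ^+ 5) = D.
Proof.
have D10 : T 5 (D ^+ 5) * (T 5 (D ^+ 5) - D) = 0.
  have := T5_D_recurrence 4; rewrite (T5_DX_small (k := 4)) // mulr0 addr0.
  by rewrite (exprM D 5 2) T5_sqr expr2 mulrBr => ->; rewrite mulrC subrr.
have [/(congr1 (fun f : fps 'F_2 => f 1%N))|/subr0_eq//] := fps_mulf_eq0 D10.
rewrite T_section_expand fps_coefD fps_coef_expand -[fps_section _ _ _]/((D ^+ 5) 5%N).
by rewrite (D_lead 5).2 addr0 => /eqP; rewrite oner_eq0.
Qed.

(** * Polynomials in D^6, triangularity and bijectivity *)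

(** Combinations of the D^(6 i + r) are written D^r q(D^6), so that the size of [q] tracks the
    leading exponent. *)
Definition evalD6 (q : {poly 'F_2}) : fps 'F_2 := horner_alg (D ^+ 6) q.

Lemma evalD6D p q : evalD6 (p + q) = evalD6 p + evalD6 q.
Proof. exact: rmorphD. Qed.

Lemma evalD6B p q : evalD6 (p - q) = evalD6 p - evalD6 q.
Proof. exact: rmorphB. Qed.

Lemma evalD6_0 : evalD6 0 = 0.
Proof. exact: rmorph0. Qed.

Lemma evalD6Z a q : evalD6 (a *: q) = a *: evalD6 q.
Proof. by rewrite /evalD6 -mul_polyC rmorphM /= horner_algC mulr_algl. Qed.

Lemma evalD6Xn n : evalD6 'X^n = D ^+ (6 * n).
Proof. by rewrite /evalD6 rmorphXn /= horner_algX -exprM. Qed.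

Lemma evalD6_mulX q : evalD6 ('X * q) = D ^+ 6 * evalD6 q.
Proof. by rewrite /evalD6 rmorphM /= horner_algX. Qed.

Lemma evalD6_sum n (F : 'I_n -> {poly 'F_2}) :
  evalD6 (\sum_(i < n) F i) = \sum_(i < n) evalD6 (F i).
Proof. exact: rmorph_sum. Qed.

Lemma evalD6E (q : {poly 'F_2}) n :
  (size q <= n)%N -> evalD6 q = \sum_(i < n) q`_i *: D ^+ (6 * i).
Proof.
move=> qn; have {1}-> : q = \sum_(i < n) q`_i *: 'X^i.
  rewrite -poly_def; apply/polyP => i; rewrite coef_poly; case: ltnP => // ni.
  by rewrite nth_default // (leq_trans qn).
by rewrite evalD6_sum; apply: eq_bigr => i _; rewrite evalD6Z evalD6Xn.
Qed.

Lemma size_mulX_leq (R : nzRingType) (q : {poly R}) m :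
  (size q <= m)%N -> (size ('X * q)%R <= m.+1)%N.
Proof.
move=> qm; rewrite -commr_polyX; have [->|/size_mulX->//] := eqVneq q 0.
by rewrite mul0r size_poly0.
Qed.

Lemma size_add_leq (R : nzRingType) (p q : {poly R}) m :
  (size p <= m)%N -> (size q <= m)%N -> (size (p + q)%R <= m)%N.
Proof. by move=> pm qm; rewrite (leq_trans (size_polyD _ _)) // geq_max pm. Qed.

Lemma size_leq_pred_eq0 (R : nzRingType) (q : {poly R}) :
  (size q <= (size q).-1)%N -> q = 0.
Proof. by move=> sq; apply/eqP; rewrite -size_poly_eq0; lia. Qed.

(** The recurrence links the exponents n, n + 1 and n + 6, so all six residue classes are carried
    together. T_5 sends class j to class -j mod 6, and only class 5 attains degree m in D^6. *)
Lemma T5_DX m : exists a0 a1 a2 a3 a4 b : {poly 'F_2},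
  [/\ all (fun q : {poly 'F_2} => size q <= m)%N [:: a0; a1; a2; a3; a4; b],
     T 5 (D ^+ (6 * m)) = evalD6 a0 /\ T 5 (D ^+ (6 * m + 1)) = D ^+ 5 * evalD6 a1,
     T 5 (D ^+ (6 * m + 2)) = D ^+ 4 * evalD6 a2 /\
       T 5 (D ^+ (6 * m + 3)) = D ^+ 3 * evalD6 a3,
     T 5 (D ^+ (6 * m + 4)) = D ^+ 2 * evalD6 a4
   & T 5 (D ^+ (6 * m + 5)) = D * evalD6 ('X^m + b)].
Proof.
elim: m => [|m [a0 [a1 [a2 [a3 [a4 [b [sz [T0 T1] [T2 T3] T4 T5']]]]]]]].
  exists 0, 0, 0, 0, 0, 0; rewrite /= !size_poly0 muln0 !add0n evalD6_0 !mulr0.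
  by rewrite T5_D5 !T5_DX_small // addr0 evalD6Xn mulr1.
have rec j : T 5 (D ^+ (6 * m.+1 + j)) =
    D * T 5 (D ^+ (6 * m + j.+1)) + D ^+ 6 * T 5 (D ^+ (6 * m + j)).
  by rewrite addnS -T5_D_recurrence; congr (T 5 (D ^+ _)); lia.
(* Here n + 1 = 6 (m + 1) already lies in the new block, so [rec0] has to be substituted as well. *)
have rec5 : T 5 (D ^+ (6 * m.+1 + 5)) =
    D * T 5 (D ^+ (6 * m.+1)) + D ^+ 6 * T 5 (D ^+ (6 * m + 5)).
  rewrite (_ : (6 * m.+1 + 5 = 6 * m + 5 + 6)%N); last lia.
  by rewrite T5_D_recurrence; do 3?congr (_ + _); congr (D * T 5 (D ^+ _)); lia.
have := rec 0%N; rewrite !addn0 T1 T0 => rec0.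
have E0 (d x y : fps 'F_2) : d * (d ^+ 5 * x) + d ^+ 6 * y = d ^+ 6 * (x + y) by ring.
have E1 k (d x y : fps 'F_2) :
    d * (d ^+ k * x) + d ^+ 6 * (d ^+ k.+1 * y) = d ^+ k.+1 * (x + d ^+ 6 * y).
  by rewrite [d ^+ k.+1]exprS; ring.
have E5 (d x0 x1 x y : fps 'F_2) :
    d * (d * (d ^+ 5 * x1) + d ^+ 6 * x0) + d ^+ 6 * (d * (x + y)) =
    d * (d ^+ 6 * x + d ^+ 6 * (x0 + x1 + y)) by ring.
move: sz; rewrite /= andbT => /and5P[s0 s1 s2 s3 /andP[s4 sb]].
exists ('X * (a1 + a0)), (a2 + 'X * a1), (a3 + 'X * a2), (a4 + 'X * a3),
  ('X^m + b + 'X * a4), ('X * (a0 + a1 + b)); split.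
- have sW q : (size q <= m)%N -> (size q <= m.+1)%N by move/leq_trans; apply.
  rewrite /= andbT; do ?[apply/andP; split];
    by do ?[apply: size_add_leq | apply: size_mulX_leq]; rewrite ?size_polyXn ?sW.
- by rewrite rec0 (rec 1%N) T2 T1 !(evalD6D, evalD6_mulX); split; [exact: E0 | exact: (E1 4)].
- split; [rewrite (rec 2) T3 T2 | rewrite (rec 3) T4 T3]; rewrite !(evalD6D, evalD6_mulX).
    exact: (E1 3).
  exact: (E1 2).
- by rewrite (rec 4) T5' T4 !(evalD6D, evalD6_mulX); exact: (E1 1%N).
- by rewrite rec5 rec0 T5' (exprS 'X m) !(evalD6D, evalD6_mulX); exact: E5.
Qed.

Lemma T5_D6m5 m : exists b : {poly 'F_2},
  (size b <= m)%N /\ T 5 (D ^+ 5 * evalD6 'X^m) = D * evalD6 ('X^m + b).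
Proof.
have [a0 [a1 [a2 [a3 [a4 [b [sz _ _ _ T5m]]]]]]] := T5_DX m; exists b.
split; first by case/and5P: sz => _ _ _ _ /and3P[].
by rewrite {1}evalD6Xn -exprD addnC.
Qed.

(** D^6 has no constant term, so the constant coefficient of [q] vanishes; then D^6 is cancelled. *)
Lemma evalD6_inj q : evalD6 q = 0 -> q = 0.
Proof.
elim/poly_ind: q => [//|q c IH]; rewrite commr_polyX evalD6D evalD6_mulX.
rewrite -alg_polyC evalD6Z -(expr0 'X) evalD6Xn muln0 expr0 mulrC => qc0.
have c0 : c = 0.
  have /(congr1 (fun f : fps 'F_2 => f 0)) := qc0.
  rewrite fps_coefD fps_coefM big_ord1 (D_lead 6).1 // mulr0 add0r.
  by rewrite -[RHS]/0 => <-; rewrite /= mulr1.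
move: qc0; rewrite c0 scale0r addr0 => /fps_mulf_eq0[/IH->|/DX_neq0//].
by rewrite mulr0 add0r scale0r.
Qed.

Lemma span_DX_mod6 r v : (0 < r < 6)%N ->
  lspan [set f | exists k : nat, [/\ (0 < k)%N, (k = r %[mod 6])%N & f = D ^+ k]] v <->
  exists q : {poly 'F_2}, v = D ^+ r * evalD6 q.
Proof.
move=> /andP[r0 r6]; split=> [[n [a [u [uP ->]]]]|[q ->]].
  elim/big_ind: _ => [|_ _ [p ->] [q ->]|i _].
  - by exists 0; rewrite evalD6_0 mulr0.
  - by exists (p + q); rewrite evalD6D mulrDr.
  have [k [_ kr ->]] := uP i; exists (a i *: 'X^(k %/ 6)).
  rewrite evalD6Z evalD6Xn -scalerAr -exprD.
  by congr (_ *: D ^+ _); move: kr; rewrite [(r %% 6)%N]modn_small //; lia.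
exists (size q), (fun i => q`_i), (fun i => D ^+ (6 * i + r)); split.
  by move=> i; exists (6 * i + r)%N; split=> //; [lia|rewrite mulnC modnMDl].
rewrite (evalD6E (leqnn _)) mulr_sumr; apply: eq_bigr => i _.
by rewrite -scalerAr -exprD addnC.
Qed.

(** By linearity from the monomials: the correction to 'X^i has degree below i. So T_5 is
    unitriangular in the bases D^(6 i + 5) and D^(6 i + 1). *)
Lemma T5_evalD6 (q : {poly 'F_2}) : exists q' : {poly 'F_2},
  (size q' <= (size q).-1)%N /\ T 5 (D ^+ 5 * evalD6 q) = D * evalD6 (q + q').
Proof.
have /choice[b bP] := T5_D6m5.
exists (\sum_(i < size q) q`_i *: b i); split.
  apply: (leq_trans (size_sum _ _ _)); apply/bigmax_leqP => i _.
  apply: (leq_trans (size_scale_leq _ _)); apply: (leq_trans (bP i).1).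
  by have := ltn_ord i; lia.
have -> : evalD6 q = \sum_(i < size q) q`_i *: evalD6 'X^i.
  by rewrite (evalD6E (leqnn _)); apply: eq_bigr => i _; rewrite evalD6Xn.
rewrite evalD6D [evalD6 q](evalD6E (leqnn _)) evalD6_sum -big_split /= !mulr_sumr T_sum.
apply: eq_bigr => i _; rewrite evalD6Z -scalerDr -!scalerAr T_scale (bP i).2.
by rewrite evalD6D evalD6Xn.
Qed.

(** Back substitution: [q] itself maps to D (q + q')(D^6) with [q'] smaller, and a preimage of the
    error is subtracted. *)
Lemma T5_evalD6_surj (q : {poly 'F_2}) :
  exists p : {poly 'F_2}, T 5 (D ^+ 5 * evalD6 p) = D * evalD6 q.
Proof.
have [n] := ubnP (size q); elim: n q => // n IH q; rewrite ltnS => sq.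
have [q0|q0] := eqVneq q 0.
  exists 0; have [q' [sq' ->]] := T5_evalD6 0.
  move: sq'; rewrite size_poly0 leqn0 size_poly_eq0 => /eqP->.
  by rewrite addr0 q0.
have [q' [sq' Tq]] := T5_evalD6 q.
have [|p Tp] := IH q'; first by move: sq' q0; rewrite -size_poly_gt0; lia.
exists (q - p); rewrite evalD6B mulrBr T_sub.
apply: (etrans (congr2 (fun f g => f - g) Tq Tp)).
by rewrite evalD6D (mulrDr D (evalD6 q) (evalD6 q')); exact: addrK.
Qed.

Theorem theorem4p20 :
  (forall m : nat, exists A : {set 'I_m},
     T 5 (D ^+ (6 * m + 5)) =
       D ^+ (6 * m + 1) + \sum_(r in A) D ^+ (6 * r + 1))
  /\ set_bij W5 W1 (T 5).
Proof.
split=> [m|].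
  have [b [sb]] := T5_D6m5 m; rewrite evalD6Xn -exprD addnC => ->.
  (* Over F_2 the correction is the plain sum over the support of [b]. *)
  exists [set r : 'I_m | b`_r != 0]; rewrite evalD6D evalD6Xn mulrDr -exprS addn1.
  congr (_ + _); rewrite (evalD6E sb) mulr_sumr [RHS]big_mkcond.
  apply: eq_bigr => r _; rewrite inE [b`_r]F2E -scalerAr -exprS addn1.
  by case: (b`_r != 0); rewrite ?scale1r ?scale0r.
have W5E v : W5 v <-> exists q, v = D ^+ 5 * evalD6 q by exact: span_DX_mod6.
have W1E v : W1 v <-> exists q, v = D * evalD6 q by exact: (@span_DX_mod6 1).
split.
- move=> v /W5E[q ->]; have [q' [_ ->]] := T5_evalD6 q.
  by apply/W1E; exists (q + q').
- move=> v w; rewrite !inE => /W5E[p ->] /W5E[q ->] Tpq.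
  (* If the image of p - q vanishes then p - q = -r with [r] of smaller size unless p - q is
     zero. *)
  have [r [sr]] := T5_evalD6 (p - q).
  have -> : T 5 (D ^+ 5 * evalD6 (p - q)) = 0.
    by rewrite evalD6B mulrBr T_sub; apply/eqP; rewrite subr_eq0; apply/eqP.
  move=> /esym Dpq.
  have [D0|] := fps_mulf_eq0 Dpq.
    by case: (@DX_neq0 1).
  move/evalD6_inj/addr0_eq => pq; move: sr; rewrite -pq size_polyN.
  by move/size_leq_pred_eq0/subr0_eq->.
move=> w /W1E[q ->].
have [p Tp] := T5_evalD6_surj q.
exists (D ^+ 5 * evalD6 p); last exact: Tp.
by apply/W5E; exact: (ex_intro _ p erefl).
Qed.
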